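(* Let $\mathfrak{G}$ be a group, let $Q$ be a finite spin set (a finite set with a right action of $\mathfrak{G}$), let $\Phi$ be a $\mathfrak{G}$-gain graph of finite order, and let $e$ be any link of $\Phi$ (an edge with two distinct endpoints). Then $$\chi_\Phi(Q) = \chi_{\Phi\smallsetminus e}(Q) - \chi_{\Phi/e}(Q),$$ where $\chi_\Phi(Q)$ is the number of totally frustrated states of $\Phi$ with spins in $Q$.
   Context: Graphs may have loops and multiple edges; the order is the number $|V|$ of vertices. A $\mathfrak{G}$-gain graph $\Phi=(\Gamma,\phi)$ consists of an underlying graph $\Gamma=(V,E)$ and a gain function $\phi$ assigning to each oriented edge an element of $\mathfrak{G}$, with $\phi(e^{-1})=\phi(e)^{-1}$, where $e^{-1}$ is $e$ with the opposite orientation. A state is any function $s:V\to Q$, $v\mapsto s_v$. An edge $e$, oriented from $v$ to $w$ (possibly $v=w$), is satisfied in $s$ if $s_w=s_v\phi(e)$ and frustrated otherwise (this does not depend on the orientation chosen). A state is totally frustrated if every edge is frustrated. $\chi_\Phi(Q)$ denotes the number of totally frustrated states. Deletion: $\Phi\smallsetminus e$ is $\Phi$ with the edge $e$ removed. Switching: for a function $\eta:V\to\mathfrak{G}$, $\Phi^\eta$ has the same underlying graph as $\Phi$ and gain function $\phi^\eta(f)=\eta_v^{-1}\phi(f)\eta_w$ for each edge $f$ oriented from $v$ to $w$. Contraction of a link $e$: switch $\Phi$ by some $\eta$ such that $\phi^\eta(e)=1$, then delete $e$ and identify its two endpoints, all other edges keeping their gains in $\Phi^\eta$; the result is $\Phi/e$.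 It is defined only up to switching, and the number of totally frustrated states is unaffected by switching; the identity is asserted for any such choice of $\Phi/e$. *)

(* Defs.v *)
From HB Require Import structures.
From mathcomp Require Import all_boot.
From mathcomp Require Export boolp.

Set Implicit Arguments.
Unset Strict Implicit.
Unset Printing Implicit Defensive.

Local Open Scope group_scope.

(* [action] in fingroup is restricted to finite acting groups, so right actions
   of an arbitrary group are defined here. *)
Record right_action (G : groupType) (Q : Type) := RightAction {
  act :> Q -> G -> Q;
  act1 : forall q, act q 1 = q;
  actM : forall q g h, act q (g * h) = act (act q g) h
}.

(* Loops and multiple edges are allowed, and the edge set may be infinite.
   [src] and [tgt] only fix a reference orientation of each edge. *)
Record graph (V : Type) := Graph {
  edge : Type;
  src : edge -> V;
  tgt : edge -> V
}.

(* [(f, true)] is [f] in its reference orientation, [(f, false)] is [f] in the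
   opposite one; the two are distinct even when [f] is a loop. *)
Definition oriented_edge (V : Type) (Gamma : graph V) : Type :=
  (edge Gamma * bool)%type.

Definition rev_edge (V : Type) (Gamma : graph V) (o : oriented_edge Gamma) :
  oriented_edge Gamma := (o.1, ~~ o.2).

Definition edge_tail (V : Type) (Gamma : graph V) (o : oriented_edge Gamma) : V :=
  if o.2 then src o.1 else tgt o.1.

Definition edge_head (V : Type) (Gamma : graph V) (o : oriented_edge Gamma) : V :=
  if o.2 then tgt o.1 else src o.1.

Definition is_link (V : Type) (Gamma : graph V) (f : edge Gamma) : Prop :=
  src f <> tgt f.

Record gain_graph (G : groupType) (V : Type) := GainGraph {
  ugraph :> graph V;
  gain : oriented_edge ugraph -> G;
  gain_rev : forall o, gain (rev_edge o) = (gain o)^-1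
}.

Arguments gain {G V} g o.

Section TotallyFrustrated.
Variables (G : groupType) (Q : finType) (aQ : right_action G Q) (V : finType).
Variable Phi : gain_graph G V.

Definition satisfied (s : V -> Q) (o : oriented_edge Phi) : Prop :=
  s (edge_head o) = aQ (s (edge_tail o)) (gain Phi o).

Lemma satisfied_rev (s : V -> Q) (o : oriented_edge Phi) :
  satisfied s (rev_edge o) <-> satisfied s o.
Proof.
rewrite /satisfied gain_rev.
case: o => f b; rewrite /edge_head /edge_tail /rev_edge /=.
by split; case: b => /= ->; rewrite -actM ?mulgV ?mulVg act1.
Qed.

(* By [satisfied_rev], the orientation chosen for [f] is immaterial. *)
Definition frustrated (s : V -> Q) (f : edge Phi) : Prop :=
  ~ satisfied s (f, true).

Definition totally_frustrated (s : V -> Q) : Prop :=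
  forall f : edge Phi, frustrated s f.

Definition chi : nat :=
  #|[set s : {ffun V -> Q} | `[< totally_frustrated s >]]|.

End TotallyFrustrated.

Arguments chi {G Q} aQ {V} Phi.

Section Deletion.
Variables (G : groupType) (V : Type) (Phi : gain_graph G V) (e : edge Phi).

Definition delete_graph : graph V :=
  @Graph V {f : edge Phi | f <> e} (fun f => src (sval f))
    (fun f => tgt (sval f)).

Definition delete_gain (o : oriented_edge delete_graph) : G :=
  gain Phi (sval o.1, o.2).

Lemma delete_gain_rev o : delete_gain (rev_edge o) = (delete_gain o)^-1.
Proof. by rewrite -gain_rev. Qed.

Definition delete : gain_graph G V := GainGraph delete_gain_rev.

End Deletion.

Arguments delete {G V} Phi e.

Section Switching.
Variables (G : groupType) (V : Type) (Phi : gain_graph G V) (eta : V -> G).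

Definition switch_gain (o : oriented_edge Phi) : G :=
  (eta (edge_tail o))^-1 * gain Phi o * eta (edge_head o).

Lemma switch_gain_rev o : switch_gain (rev_edge o) = (switch_gain o)^-1.
Proof.
rewrite /switch_gain gain_rev !invgM invgK mulgA.
by case: o => f [].
Qed.

Definition switch : gain_graph G V := GainGraph switch_gain_rev.

End Switching.

Arguments switch {G V} Phi eta.

Section Identification.
Variables (V : finType) (v w : V).

Definition same_vertex : rel V :=
  fun x y => (x == y) || (x \in [:: v; w]) && (y \in [:: v; w]).

Lemma same_vertex_refl : reflexive same_vertex.
Proof. by move=> x; rewrite /same_vertex eqxx. Qed.

Lemma same_vertex_sym : symmetric same_vertex.
Proof. by move=> x y; rewrite /same_vertex eq_sym andbC. Qed.

Lemma same_vertex_trans : transitive same_vertex.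
Proof.
move=> y x z /orP[/eqP-> //|/andP[xvw yvw]] /orP[/eqP<-|/andP[_ zvw]];
  by rewrite /same_vertex xvw ?yvw ?zvw orbT.
Qed.

Canonical same_vertex_equiv :=
  EquivRel same_vertex same_vertex_refl same_vertex_sym same_vertex_trans.

Definition merged_vertex : Type := {eq_quot same_vertex}%qT.
HB.instance Definition _ := [Finite of merged_vertex by <:%/].

Definition merge_vertex (x : V) : merged_vertex := \pi_({eq_quot same_vertex})%qT x.

Lemma merge_vertexP (x y : V) : reflect (merge_vertex x = merge_vertex y) (same_vertex x y).
Proof. exact: (eqmodP _ x y). Qed.

Variables (G : groupType) (Phi : gain_graph G V).

Definition identify_graph : graph merged_vertex :=
  @Graph merged_vertex (edge Phi) (fun f => merge_vertex (src f))
    (fun f => merge_vertex (tgt f)).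

Definition identify_gain (o : oriented_edge identify_graph) : G :=
  gain Phi o.

Lemma identify_gain_rev o : identify_gain (rev_edge o) = (identify_gain o)^-1.
Proof. exact: gain_rev. Qed.

Definition identify : gain_graph G merged_vertex := GainGraph identify_gain_rev.

End Identification.

(* This is a contraction of the link [e] when [eta] switches its gain to 1. *)
Definition contract (G : groupType) (V : finType) (Phi : gain_graph G V)
    (e : edge Phi) (eta : V -> G) :
  gain_graph G (merged_vertex (src e) (tgt e)) :=
  identify (src e) (tgt e) (delete (switch Phi eta) e).

Arguments contract {G V} Phi e eta.

Lemma contraction_exists (G : groupType) (V : finType) (Phi : gain_graph G V)
    (e : edge Phi) :
  is_link e -> exists eta : V -> G, gain (switch Phi eta) (e, true) = 1.
Proof.
move=> /eqP ne; exists (fun x => if x == src e then gain Phi (e, true) else 1).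
rewrite /= /switch_gain /edge_tail /edge_head /= eqxx.
by rewrite (eq_sym (tgt e)) (negPf ne) mulVg mulg1.
Qed.

(* Main.v *)
Require Import Defs.
From mathcomp Require Import all_boot all_order ssralg ssrint.
Import GRing.Theory.
Local Open Scope ring_scope.

Set Implicit Arguments.
Unset Strict Implicit.
Unset Printing Implicit Defensive.

(* The totally frustrated states of [delete Phi e] that frustrate [e] are those
   of [Phi]. After switching, the ones that satisfy [e] take equal values at
   both ends of [e], so they are the totally frustrated states of the
   contraction, pulled back along the identification of the two ends. *)

Lemma actK (G : groupType) (Q : Type) (aQ : right_action G Q) (g : G) :
  cancel (aQ^~ g) (aQ^~ (g^-1)%g).
Proof. by move=> q /=; rewrite -actM mulgV act1. Qed.

Lemma actKV (G : groupType) (Q : Type) (aQ : right_action G Q) (g : G) :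
  cancel (aQ^~ (g^-1)%g) (aQ^~ g).
Proof. by move=> q /=; rewrite -actM mulVg act1. Qed.

(** The factor [eta] at the tail cancels against the inverse in the switched gain, and both sides
    are then moved by [eta] at the head, which acts injectively. *)
Lemma satisfied_switch (G : groupType) (Q : finType) (aQ : right_action G Q)
    (V : finType) (Phi : gain_graph G V) (eta : V -> G) (s : V -> Q)
    (o : oriented_edge Phi) :
  satisfied (Phi := switch Phi eta) aQ (fun x => aQ (s x) (eta x)) o <->
  satisfied aQ s o.
Proof.
rewrite /satisfied /= /switch_gain -actM !mulgA mulgV mul1g actM.
by split=> [/(can_inj (actK aQ _))|->].
Qed.

Lemma satisfied_gain1 (G : groupType) (Q : finType) (aQ : right_action G Q)
    (V : finType) (Phi : gain_graph G V) (e : edge Phi) (eta : V -> G)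
    (eta_e : gain (switch Phi eta) (e, true) = 1%g) (s : V -> Q) :
  satisfied aQ s (e, true) <->
  aQ (s (tgt e)) (eta (tgt e)) = aQ (s (src e)) (eta (src e)).
Proof. by rewrite -(satisfied_switch aQ eta) /satisfied eta_e act1. Qed.

Lemma totally_frustrated_delete (G : groupType) (Q : finType)
    (aQ : right_action G Q) (V : finType) (Phi : gain_graph G V) (e : edge Phi)
    (s : V -> Q) :
  totally_frustrated aQ Phi s <->
  totally_frustrated aQ (delete Phi e) s /\ frustrated aQ s e.
Proof.
split=> [frs | [frs fre] f]; first by split=> [f|]; apply: frs.
(* Edges form an arbitrary type, so this case split is classical. *)
have [->//|ne] := pselect (f = e).
exact: (frs (exist _ f ne)).
Qed.

(** Contraction and deletion have the same edges, and [st] makes [t] the switched form of [s].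
    Relating [s] and [t] by a hypothesis lets either one be built from the other. *)
Lemma totally_frustrated_contract (G : groupType) (Q : finType)
    (aQ : right_action G Q) (V : finType) (Phi : gain_graph G V) (e : edge Phi)
    (eta : V -> G) (s : V -> Q) (t : merged_vertex (src e) (tgt e) -> Q)
    (st : forall x, t (merge_vertex _ _ x) = aQ (s x) (eta x)) :
  totally_frustrated aQ (contract Phi e eta) t <->
  totally_frustrated aQ (delete Phi e) s.
Proof.
have sat f : satisfied aQ (Phi := contract Phi e eta) t (f, true) <->
    satisfied aQ (Phi := delete Phi e) s (f, true).
  rewrite /satisfied /edge_head /edge_tail /= !st.
  exact: (satisfied_switch aQ (Phi := Phi) eta s (sval f, true)).
by split=> fr f; have := fr f; rewrite /frustrated sat.
Qed.

(** Pulling a state back to [V] and undoing the switching is injective; its image is the set on the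
    right. *)
Lemma chi_contract (G : groupType) (Q : finType) (aQ : right_action G Q)
    (V : finType) (Phi : gain_graph G V) (e : edge Phi) (eta : V -> G)
    (eta_e : gain (switch Phi eta) (e, true) = 1%g) :
  chi aQ (contract Phi e eta) =
  #|[set s : {ffun V -> Q} |
      `[< totally_frustrated aQ (delete Phi e) s /\
          satisfied aQ s (e, true) >]]|.
Proof.
pose m := merge_vertex (src e) (tgt e).
pose lift (t : {ffun merged_vertex (src e) (tgt e) -> Q}) : {ffun V -> Q} :=
  [ffun x => aQ (t (m x)) (eta x)^-1%g].
have liftE (t : {ffun _ -> Q}) x : t (m x) = aQ (lift t x) (eta x) by rewrite ffunE actKV.
have lift_inj : injective lift.
  move=> t u tu; apply/ffunP => y.
  have -> : y = m (repr y) by rewrite /m /merge_vertex reprK.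
  by rewrite !liftE tu.
rewrite /chi -(card_imset _ lift_inj); apply: eq_card => s.
rewrite [RHS]inE; apply/imsetP/asboolP => [[t]|[frs]].
  rewrite inE => /asboolP frt ->; split.
    exact/(totally_frustrated_contract (liftE t)).
  apply/(satisfied_gain1 aQ eta_e); rewrite -!liftE; congr (t _).
  (* Both ends of [e] lie in one class, where [t] has a single value. *)
  by apply/merge_vertexP; rewrite /same_vertex !inE !eqxx !orbT.
move/(satisfied_gain1 aQ eta_e) => se.
(* The preimage of [s] is read off at class representatives; [tE] shows that any other member of the
   class gives the same value. *)
pose t : {ffun merged_vertex (src e) (tgt e) -> Q} :=
  [ffun y : merged_vertex (src e) (tgt e) =>
    aQ (s (repr y)) (eta (repr y))].
have tE x : t (m x) = aQ (s x) (eta x).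
  rewrite ffunE.
  have /merge_vertexP : m (repr (m x)) = m x by rewrite /m /merge_vertex reprK.
  case/orP => [/eqP->//|].
  (* Here [x] and its representative are both ends of [e], and [se] equates the two values. *)
  by rewrite !inE => /andP[/orP[]/eqP-> /orP[]/eqP->].
exists t; last by apply/ffunP => x; rewrite ffunE tE actK.
by rewrite inE; apply/asboolP/(totally_frustrated_contract tE).
Qed.

Theorem theorem1 (G : groupType) (Q : finType) (aQ : right_action G Q)
    (V : finType) (Phi : gain_graph G V) (e : edge Phi) (eta : V -> G)
    (e_link : is_link e)
    (eta_e : gain (switch Phi eta) (e, true) = 1%g) :
  (chi aQ Phi)%:Z = (chi aQ (delete Phi e))%:Z - (chi aQ (contract Phi e eta))%:Z.
Proof.
suff -> : chi aQ (delete Phi e) = (chi aQ (contract Phi e eta) + chi aQ Phi)%N.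
  by rewrite PoszD addrAC subrr add0r.
rewrite (chi_contract aQ eta_e) /chi.
(* Split the states of the deletion by whether they satisfy [e]. *)
rewrite -(cardsID [set s : {ffun V -> Q} | `[< satisfied aQ s (e, true) >]]).
congr (_ + _)%N; apply: eq_card => s; rewrite !inE.
  by rewrite asbool_and.
rewrite -asbool_neg andbC -asbool_and; apply: asbool_equiv_eq.
exact: iff_sym (totally_frustrated_delete aQ e s).
Qed.
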